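(* Let $n\geq 3$ and let $G=(V,E)$ be a cycle graph with $n$ vertices, with a fixed partition $E=E_{\mathrm{refl}}\sqcup E_{\mathrm{refr}}$ into reflection edges and refraction edges such that $|E_{\mathrm{refr}}|$ is even. Let $\sigma\in\Lambda_G$. Then the orbit of $\Theta$ containing $(\sigma,1,1)$ has size \[\frac{n\,p_\sigma}{\gcd(n,\mu_\sigma)}\Big(\mu_\sigma m_\sigma+(n-\mu_\sigma)(n-1-m_\sigma)\Big).\]
   Context: For $i\in\mathbb{Z}/n\mathbb{Z}$, $s_i$ is the transposition of $\mathbb{Z}/n\mathbb{Z}$ swapping $i$ and $i+1$. A labeling of $G$ is a bijection $V\to\mathbb{Z}/n\mathbb{Z}$; $\Lambda_G$ is the set of labelings. Let $\Xi_G=\Lambda_G\times\mathbb{Z}/n\mathbb{Z}\times\{\pm1\}$ and define $\Theta(\sigma,i,\epsilon)=(s_i\circ\sigma,i+\epsilon,\epsilon)$ if $\{\sigma^{-1}(i),\sigma^{-1}(i+1)\}\notin E$; $(\sigma,i+\epsilon,\epsilon)$ if $\{\sigma^{-1}(i),\sigma^{-1}(i+1)\}\in E_{\mathrm{refl}}$; $(s_i\circ\sigma,i-\epsilon,-\epsilon)$ if $\{\sigma^{-1}(i),\sigma^{-1}(i+1)\}\in E_{\mathrm{refr}}$. Given $\sigma$, name the vertices of $G$ as $v_1,\dots,v_n$ in order along the cycle (so the edges are $\{v_k,v_{k+1}\}$ and $\{v_n,v_1\}$), choosing the starting vertex and direction so that $\sigma(v_n)=1$ and $\sigma(v_1)<\sigma(v_{n-1})$,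 where $\mathbb{Z}/n\mathbb{Z}$ is identified with $\{1,\dots,n\}$. For distinct $x,y\in\mathbb{Z}/n\mathbb{Z}$ let $\mathrm{arc}(x,y)=\{x+1,x+2,\dots,y-1\}\subseteq\mathbb{Z}/n\mathbb{Z}$ (the elements strictly between $x$ and $y$ going upward cyclically). Let $a_0=1+|\{k\in\{1,\dots,n-1\}:\sigma(v_k)\in\mathrm{arc}(\sigma(v_{n-1}),\sigma(v_1))\}|$ and, for $1\le j\le n-2$, $a_j=1+|\{k\in\{1,\dots,n-1\}:\sigma(v_k)\in\mathrm{arc}(\sigma(v_j),\sigma(v_{j+1}))\}|$. Extend to an infinite sequence $(a_\beta)_{\beta\ge0}$ by $a_{j+n-1}=a_j$. Then $\sum_{\ell=0}^{n-2}a_\ell=m_\sigma(n-1)$ for a positive integer $m_\sigma$; let $p_\sigma$ be the (minimal) period of $(a_\beta)_{\beta\ge0}$. Since $|E_{\mathrm{refr}}|$ is even, there is a unique partition $V=Y_1\sqcup Y_{-1}$ such that every refraction edge has one endpoint in each part, every reflection edge has both endpoints in the same part, and $v_n\in Y_1$; let $\mu_\sigma=|Y_1|$. *)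

(* Defs.v *)
From HB Require Import structures.
From mathcomp Require Import all_boot all_order all_algebra perm zify ring.
Set Implicit Arguments.
Unset Strict Implicit.
Unset Printing Implicit Defensive.
Import GRing.Theory.
Local Open Scope ring_scope.

(* ['Z_n] is the ring of integers modulo n only when 1 < n; everything below  *)
(* is meant for 2 < n.                                                        *)

Definition bijectiveb (aT rT : finType) (f : aT -> rT) : bool :=
  injectiveb f && [forall y, y \in codom f].

Lemma bijectivebP (aT rT : finType) (f : aT -> rT) :
  reflect (bijective f) (bijectiveb f).
Proof.
apply: (iffP andP) => [[/injectiveP f_inj /forallP f_surj]|f_bij].
  by exists (fun y => iinv (f_surj y)) => x; [exact: iinv_f | exact: f_iinv].
split; first by apply/injectiveP; exact: bij_inj.
by case: f_bij => g _ gK; apply/forallP => y; rewrite -(gK y) codom_f.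
Qed.

Record labeling (n : nat) (V : finType) := Labeling {
  labeling_fun :> {ffun V -> 'Z_n};
  labeling_bijb : bijectiveb labeling_fun
}.
HB.instance Definition _ (n : nat) (V : finType) :=
  [isSub for @labeling_fun n V].
HB.instance Definition _ (n : nat) (V : finType) :=
  [Finite of labeling n V by <:].

Lemma labeling_bij (n : nat) (V : finType) (sigma : labeling n V) :
  bijective sigma.
Proof. exact/bijectivebP/labeling_bijb. Qed.

Definition simple_transp (n : nat) (i : 'Z_n) : {perm 'Z_n} := tperm i (i + 1).

Lemma perm_labeling_subproof (n : nat) (V : finType) (s : {perm 'Z_n})
    (sigma : labeling n V) :
  bijectiveb [ffun x => s (sigma x)].
Proof.
apply/bijectivebP; apply: (eq_bij (f := s \o sigma)).
  by apply: bij_comp (labeling_bij sigma); exact: injF_bij perm_inj.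
by move=> x; rewrite ffunE.
Qed.

Definition perm_labeling (n : nat) (V : finType) (s : {perm 'Z_n})
    (sigma : labeling n V) : labeling n V :=
  Labeling (perm_labeling_subproof s sigma).

(* The third component encodes the sign: [true] is +1 and [false] is -1.      *)
Definition state (n : nat) (V : finType) : finType :=
  (labeling n V * 'Z_n * bool)%type.

Definition sgn_Zn (n : nat) (eps : bool) : 'Z_n := if eps then 1 else - 1.

(* As sigma is bijective, the preimage below is                               *)
(* {sigma^-1(i), sigma^-1(i+1)}.                                              *)
Definition Theta (n : nat) (V : finType) (Erefl Erefr : {set {set V}})
    (x : state n V) : state n V :=
  let: (sigma, i, eps) := x in
  let e := sigma @^-1: [set i; i + 1] in
  if e \in Erefl then (sigma, i + sgn_Zn n eps, eps)
  else if e \in Erefr then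
    (perm_labeling (simple_transp i) sigma, i - sgn_Zn n eps, ~~ eps)
  else (perm_labeling (simple_transp i) sigma, i + sgn_Zn n eps, eps).

(* v lists the vertices along the cycle graph with edge set E; v_n is [v 0].  *)
Definition cycle_enum (n : nat) (V : finType) (E : {set {set V}})
    (v : 'Z_n -> V) : Prop :=
  bijective v /\ E = [set [set v k; v (k + 1)] | k : 'Z_n].

Definition is_cycle_graph (n : nat) (V : finType) (E : {set {set V}}) : Prop :=
  exists v : 'Z_n -> V, cycle_enum E v.

(* The identification of Z/nZ with {1, ..., n}.                               *)
Definition repr1n (n : nat) (x : 'Z_n) : nat :=
  if x == 0 then n else x.

Definition naming (n : nat) (V : finType) (E : {set {set V}})
    (sigma : labeling n V) (v : 'Z_n -> V) : Prop :=
  [/\ cycle_enum E v, sigma (v 0) = 1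
    & (repr1n (sigma (v 1%R)) < repr1n (sigma (v (- 1)%R)))%N].

Definition arc (n : nat) (x y : 'Z_n) : {set 'Z_n} :=
  [set z : 'Z_n | (0 < (z - x)%R < (y - x)%R)%N].

(* The indices 1, ..., n-1 are the nonzero elements of ['Z_n].                *)
Definition gap (n : nat) (V : finType) (sigma : labeling n V)
    (v : 'Z_n -> V) (x y : 'Z_n) : nat :=
  #|[set k : 'Z_n | (k != 0) && (sigma (v k) \in arc x y)]|.+1.

Definition aseq (n : nat) (V : finType) (sigma : labeling n V)
    (v : 'Z_n -> V) (b : nat) : nat :=
  let j := (b %% n.-1)%N in
  if j == 0%N then gap sigma v (sigma (v (- 1))) (sigma (v 1))
  else gap sigma v (sigma (v j%:R)) (sigma (v j.+1%:R)).

Definition is_period (a : nat -> nat) (p : nat) : Prop :=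
  (0 < p)%N /\ forall b, a (b + p)%N = a b.

Definition is_min_period (a : nat -> nat) (p : nat) : Prop :=
  is_period a p /\ forall q, is_period a q -> (p <= q)%N.

(* Y is the part Y_1, and its complement is Y_{-1}.                           *)
Definition is_part1 (V : finType) (Erefl Erefr : {set {set V}}) (vn : V)
    (Y : {set V}) : Prop :=
  [/\ forall x y, [set x; y] \in Erefr -> (x \in Y) != (y \in Y),
      forall x y, [set x; y] \in Erefl -> (x \in Y) = (y \in Y)
    & vn \in Y].

(* The results below show that the orbits of Theta are its forward orbits     *)
(* ([Theta_inj]) and that the naming, m, p and Y always exist.                *)

Lemma perm_labelingE n (V : finType) s (sigma : labeling n V) x :
  perm_labeling s sigma x = s (sigma x).
Proof. by rewrite ffunE. Qed.

Lemma labeling_eq n (V : finType) (s t : labeling n V) : s =1 t -> s = t.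
Proof. by move=> st; apply/val_inj/ffunP. Qed.

Lemma preim_transp n (V : finType) (sigma : labeling n V) i :
  perm_labeling (simple_transp i) sigma @^-1: [set i; i + 1] =
  sigma @^-1: [set i; i + 1].
Proof.
apply/setP => x; rewrite !inE perm_labelingE.
rewrite /simple_transp; set y := sigma x.
have [->|yi] := eqVneq y i; first by rewrite tpermL eqxx orbT.
have [->|yj] := eqVneq y (i + 1); first by rewrite tpermR eqxx.
by rewrite tpermD ?(negPf yi) ?(negPf yj) // eq_sym.
Qed.

Lemma ThetaE n (V : finType) (Erefl Erefr : {set {set V}}) (sigma : labeling n V)
    (i : 'Z_n) (eps : bool) :
  let e := sigma @^-1: [set i; i + 1] in
  let eps' := eps (+) ((e \notin Erefl) && (e \in Erefr)) in
  @Theta n V Erefl Erefr (sigma, i, eps) =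
  (if e \in Erefl then sigma else perm_labeling (simple_transp i) sigma,
   i + sgn_Zn n eps', eps').
Proof.
rewrite /Theta /=; case: ifP => _ /=; first by rewrite addbF.
case: ifP => _ /=; last by rewrite addbF.
by rewrite addbT; case: eps; rewrite /sgn_Zn //= opprK.
Qed.

Lemma Theta_inj n (V : finType) (Erefl Erefr : {set {set V}}) :
  injective (@Theta n V Erefl Erefr).
Proof.
move=> [[s i] e] [[t j] d]; rewrite !ThetaE /=.
set A := s @^-1: _; set B := t @^-1: _.
move=> eqT; have /= st := congr1 (fun x => x.1.1) eqT.
have /= ij := congr1 (fun x => x.1.2) eqT.
have /= ed := congr1 snd eqT.
rewrite ed in ij; have {eqT}ij := @addIr _ _ _ _ ij; subst j.
have AB : A = B.
  transitivity ((if A \in Erefl then s else perm_labeling (simple_transp i) s)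
    @^-1: [set i; i + 1]); first by case: ifP => _ //; rewrite preim_transp.
  by rewrite st; case: ifP => _ //; rewrite preim_transp.
rewrite -AB in st ed; move/addIb: ed => ->; congr (_, _, _).
move: st; case: ifP => // _ st; apply: labeling_eq => x.
by apply: (@perm_inj _ (simple_transp i)); rewrite -!perm_labelingE st.
Qed.

Lemma modn_subE N (x y : nat) : (x < N)%N -> (y < N)%N ->
  ((x + (N - y) %% N) %% N = if y <= x then x - y else x + N - y)%N.
Proof.
move=> xlt ylt; rewrite modnDmr; case: leqP => yx.
  have -> : (x + (N - y) = (x - y) + N)%N by lia.
  by rewrite modnDr modn_small //; lia.
by rewrite modn_small; lia.
Qed.

Lemma val_ZpB n (x y : 'Z_n.+3) :
  val (x - y) = if (y <= x)%N then (x - y)%N else (x + n.+3 - y)%N.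
Proof. exact: modn_subE (ltn_ord x) (ltn_ord y). Qed.

Lemma repr1nE n (x : 'Z_n.+3) : repr1n x = (val (x - 1)).+1.
Proof.
rewrite /repr1n val_ZpB -val_eqE /=.
by case: (x : nat) => [|k] //=; rewrite subn1.
Qed.

Lemma repr1n_inj n : injective (@repr1n n.+3).
Proof.
move=> x y; rewrite !repr1nE => /succn_inj eqxy.
have {}eqxy : x - 1 = y - 1 by apply: val_inj.
by rewrite -(subrK 1 x) eqxy subrK. Qed.

Lemma cycle_enumD n (V : finType) (E : {set {set V}}) (w : 'Z_n -> V) c :
  cycle_enum E w -> cycle_enum E (fun k => w (c + k)).
Proof.
move=> [w_bij ->]; split.
  by apply: (bij_comp w_bij); exists (fun k => k - c) => k; ring.
apply/setP => e; apply/imsetP/imsetP => -[k _ ->].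
  by exists (k - c) => //; congr [set w _; w _]; ring.
by exists (c + k) => //; rewrite addrA.
Qed.

Lemma cycle_enumN n (V : finType) (E : {set {set V}}) (w : 'Z_n -> V) :
  cycle_enum E w -> cycle_enum E (fun k => w (- k)).
Proof.
move=> [w_bij ->]; split.
  by apply: (bij_comp w_bij); exists (fun k => - k) => k; ring.
by apply/setP => e; apply/imsetP/imsetP => -[k _ ->];
  exists (- k - 1) => //; rewrite setUC; congr [set w _; w _]; ring.
Qed.

Lemma one_neqN1 n : (1 : 'Z_n.+3) != - 1.
Proof. by rewrite -[- 1]add0r -val_eqE val_ZpB.
Qed.

Lemma naming_exists n (V : finType) (E : {set {set V}}) (sigma : labeling n V) :
  (2 < n)%N -> is_cycle_graph n E -> exists v, naming E sigma v.
Proof.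
case: n sigma => [|[|[|n]]] // sigma _ [w w_enum].
have [g sK gK] := labeling_bij sigma.
have [h wK hK] := w_enum.1.
pose v k := w (h (g 1) + k).
have v_enum : cycle_enum E v by apply: cycle_enumD.
have v0 : sigma (v 0) = 1 by rewrite /v addr0 hK gK.
case: (ltngtP (repr1n (sigma (v 1))) (repr1n (sigma (v (- 1))))) => [lt|gt|eq].
- by exists v.
- exists (fun k => v (- k)); split; first exact: cycle_enumN.
    by rewrite oppr0.
  by rewrite opprK.
have /eqP := repr1n_inj eq.
rewrite (bij_eq (labeling_bij sigma)) (bij_eq v_enum.1).
by rewrite (negPf (one_neqN1 n)).
Qed.

Lemma card_arc n (x y : 'Z_n.+3) : #|arc x y| = (val (y - x)).-1.
Proof.
pose d := val (y - x).
have dlt : (d < n.+3)%N := ltn_ord _.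
have -> : #|arc x y| = #|[set w : 'I_n.+3 | 0 < w < d]%N|.
  rewrite -(card_imset (mem [set w : 'I_n.+3 | 0 < w < d]%N) (@addrI _ x)).
  apply: eq_card => z; apply/idP/imsetP => [|[w]].
    by rewrite inE => zP; exists (z - x); rewrite ?inE //; ring.
  by rewrite !inE => wP ->; rewrite [x + w]addrC addrK.
rewrite -/d; clearbody d; rewrite cardE -(size_map val) -[RHS](size_iota 1).
apply/eqP; rewrite eqn_leq; apply/andP; split; apply: uniq_leq_size.
- by rewrite map_inj_uniq ?enum_uniq //; exact: val_inj.
- move=> k /mapP[w]; rewrite mem_enum inE mem_iota => /andP[w0 wd] ->.
  by rewrite w0 add1n (ltn_predK wd).
- exact: iota_uniq.
move=> k; rewrite mem_iota => kP.
have klt : (k < n.+3)%N by lia.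
apply/mapP; exists (Ordinal klt) => //.
by rewrite mem_enum inE /=; lia.
Qed.

Lemma gapE n (V : finType) (E : {set {set V}}) (sigma : labeling n.+3 V) v x y :
  naming E sigma v -> x != y -> x != 1 -> y != 1 ->
  (gap sigma v x y + repr1n x =
   repr1n y + n.+2 * (repr1n y < repr1n x))%N.
Proof.
move=> [[v_bij _] v0 _] xy x1 y1.
pose f := sigma \o v.
have f_bij : bijective f by apply: bij_comp (labeling_bij sigma) v_bij.
have -> : gap sigma v x y = #|arc x y :\ 1|.+1.
  rewrite /gap -(card_imset _ (bij_inj f_bij)); congr _.+1.
  apply: eq_card => z; apply/imsetP/idP => [[k]|].
    rewrite !inE => /andP[k0 kA] ->; rewrite -v0 -[sigma (v 0)]/(f 0).
    by rewrite (bij_eq f_bij) k0.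
  have [g fK gK] := f_bij.
  rewrite !inE => /andP[z1 zA]; exists (g z); last by rewrite gK.
  rewrite inE -[sigma _]/(f (g z)) gK inE zA andbT.
  by apply: contra z1 => /eqP gz; rewrite -(gK z) gz /f /= v0.
have := cardsD1 1 (arc x y); rewrite card_arc !repr1nE inE.
have -> : 1 - x = 0 - (x - 1) by ring.
have -> : y - x = (y - 1) - (x - 1) by ring.
have : x - 1 != y - 1 by rewrite (inj_eq (can_inj (subrK 1))).
move: x1 y1; rewrite -subr_eq0 -(subr_eq0 y).
move: (x - 1) (y - 1) => a b.
rewrite -!val_eqE !val_ZpB /= => a0 b0 ab.
have alt : (a < n.+3)%N := ltn_ord a.
have blt : (b < n.+3)%N := ltn_ord b.
move: (nat_of_ord a) (nat_of_ord b) a0 b0 ab alt blt => {}a {}b.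
rewrite ltnS; move: #|_ :\ _| => c a0 b0 ab alt blt.
case: (leqP a b) => ab' /=; case: (leqP a 0) => //= a0'; lia.
Qed.

Lemma natr_Zp_inj n i j : (i < n.+3)%N -> (j < n.+3)%N ->
  (i%:R == j%:R :> 'Z_n.+3) = (i == j).
Proof. by move=> ? ?; rewrite -val_eqE /= !Zp_nat /= !modn_small. Qed.

Lemma sum_aseq n (V : finType) (E : {set {set V}}) (sigma : labeling n V) v :
  (2 < n)%N -> naming E sigma v ->
  exists2 m, (0 < m)%N
    & (\sum_(0 <= l < n.-1) aseq sigma v l = m * n.-1)%N.
Proof.
case: n sigma v => [|[|[|n]]] // sigma v _ nv /=.
have [[v_bij _] v0 _] := nv.
have sv_eq := bij_eq (bij_comp (labeling_bij sigma) v_bij).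
pose idx l : 'Z_n.+3 := if l == 0%N then - 1 else l%:R.
have N1 : - 1 = n.+2%:R :> 'Z_n.+3.
  by apply: val_inj; rewrite -[- 1]add0r val_ZpB Zp_nat [RHS]modn_small //= subn1.
pose u l := repr1n (sigma (v (idx l))).
have step l : (l < n.+2)%N ->
    (aseq sigma v l + u l = u l.+1 + n.+2 * (u l.+1 < u l))%N.
  move=> ll; rewrite /aseq /= modn_small //.
  have -> : (if l == 0%N then gap sigma v (sigma (v (-1))) (sigma (v 1))
     else gap sigma v (sigma (v l%:R)) (sigma (v l.+1%:R))) =
     gap sigma v (sigma (v (idx l))) (sigma (v (idx l.+1))).
    by case: l ll.
  apply: gapE nv _ _ _; rewrite -?v0 [_ == _]sv_eq /idx /=.
  + case: l ll => [|l] ll; first by rewrite eq_sym one_neqN1.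
    by rewrite natr_Zp_inj //; lia.
  + case: l ll => [|l] ll; first by rewrite oppr_eq0 oner_eq0.
    by rewrite (@natr_Zp_inj n _ 0) //; lia.
  by rewrite (@natr_Zp_inj n _ 0) //; lia.
pose D := (\sum_(0 <= l < n.+2) (u l.+1 < u l))%N.
have sumE : (\sum_(0 <= l < n.+2) aseq sigma v l = D * n.+2)%N.
  have : (\sum_(0 <= l < n.+2) (aseq sigma v l + u l) =
          \sum_(0 <= l < n.+2) (u l.+1 + n.+2 * (u l.+1 < u l)))%N.
    by apply: eq_big_nat => l /andP[_ ll]; apply: step.
  rewrite !big_split /= -big_distrr /= -/D.
  have -> : (\sum_(0 <= l < n.+2) u l.+1 = \sum_(0 <= l < n.+2) u l)%N.
    rewrite big_nat_recr //= [RHS]big_nat_recl //= addnC; congr (_ + _)%N.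
    by rewrite /u /idx /= N1.
  by rewrite mulnC; lia.
exists D => //.
have : (0 < \sum_(0 <= l < n.+2) aseq sigma v l)%N.
  by rewrite big_nat_recl // /aseq /= mod0n /gap.
by rewrite sumE muln_gt0 => /andP[].
Qed.

Lemma min_period_exists n (V : finType) (sigma : labeling n V) v :
  (2 < n)%N -> exists p, is_min_period (aseq sigma v) p.
Proof.
move=> n2; have n1 : (0 < n.-1)%N by lia.
pose P p := (0 < p)%N &&
  [forall b : 'I_n.-1, aseq sigma v (b + p) == aseq sigma v b].
have PP p : reflect (is_period (aseq sigma v) p) (P p).
  apply: (iffP andP) => -[p0 per]; split=> //.
    move=> b; have bl : (b %% n.-1 < n.-1)%N by rewrite ltn_mod.
    have /eqP := forallP per (Ordinal bl).
    by rewrite /aseq /= modnDml modn_mod.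
  by apply/forallP => b; rewrite per.
have exP : exists p, P p.
  by exists n.-1; apply/PP; split=> // b; rewrite /aseq modnDr.
case: (ex_minnP exP) => p /PP Pp pmin; exists p; split=> // q /PP; exact: pmin.
Qed.

Lemma part1_exists n (V : finType) (E Erefl Erefr : {set {set V}})
    (v : 'Z_n -> V) :
  (2 < n)%N -> E = Erefl :|: Erefr -> [disjoint Erefl & Erefr] ->
  ~~ odd #|Erefr| -> cycle_enum E v -> exists Y, is_part1 Erefl Erefr (v 0) Y.
Proof.
case: n v => [|[|[|n]]] // v _ EU Edisj even_refr [v_bij EE].
pose e k := [set v k; v (k + 1)].
have e_inj : injective e.
  move=> k l /setP ekl; have v_inj := bij_inj v_bij.
  have := ekl (v k); have := ekl (v (k + 1)).
  rewrite !inE !(inj_eq v_inj) !eqxx orbT /= => /esym/orP[] /eqP k1 /esym/orP[] /eqP kl //.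
    have /eqP[] := one_neqN1 n; apply: (@addrI _ k); rewrite k1 kl; ring.
  by rewrite -(addrK 1 k) k1 addrK.
pose r k := e k \in Erefr.
pose c j := odd (\sum_(0 <= i < j) r i%:R).
have cN : c n.+3 = false.
  apply: negbTE; move: even_refr; rewrite /c big_mkord; congr (~~ odd _).
  transitivity (\sum_(i : 'Z_n.+3) r i)%N; last first.
    by apply: eq_bigr => i _; congr (nat_of_bool (r _)); rewrite natr_Zp.
  rewrite -big_mkcond sum1_card -(card_imset _ e_inj).
  apply: eq_card => f; apply/idP/imsetP => [fE|[k]]; last by rewrite unfold_in => rk ->.
  have : f \in E by rewrite EU inE fE orbT.
  by rewrite EE => /imsetP[k _ fk]; exists k; rewrite // unfold_in /r /e -fk.
have cS (k : 'Z_n.+3) : c (val (k + 1)) = c (val k) (+) r k.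
  transitivity (c (val k).+1); last first.
    by rewrite /c big_nat_recr //= oddD oddb natr_Zp.
  have /= -> : val (k + 1) = ((val k).+1 %% n.+3)%N by rewrite /= modnDmr addn1.
  have : (k < n.+3)%N := ltn_ord k.
  rewrite leq_eqVlt => /orP[/eqP ->|lt]; last by rewrite modn_small.
  by rewrite modnn cN /c big_geq.
pose Y := [set v k | k : 'Z_n.+3 & ~~ c (val k)].
have inY k : (v k \in Y) = ~~ c (val k).
  by rewrite (mem_imset _ _ (bij_inj v_bij)) inE.
have edge x y : [set x; y] \in E ->
    ((x \in Y) != (y \in Y)) = ([set x; y] \in Erefr).
  rewrite EE => /imsetP[k _ xy]; rewrite xy -/(e k) -/(r k).
  have : ((v k \in Y) != (v (k + 1) \in Y)) = r k.
    by rewrite !inY cS; case: (c _); case: (r k).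
  have v_neq : v k != v (k + 1).
    by rewrite (bij_eq v_bij) -subr_eq0 opprD addrA subrr add0r oppr_eq0 oner_eq0.
  have : x \in e k by rewrite /e -xy !inE eqxx.
  have : y \in e k by rewrite /e -xy !inE eqxx orbT.
  have : v k \in [set x; y] by rewrite xy !inE eqxx.
  have : v (k + 1) \in [set x; y] by rewrite xy !inE eqxx orbT.
  rewrite !inE => h1 h2 /orP[]/eqP yE /orP[]/eqP xE; subst x y => //.
  - by move: h1; rewrite orbb eq_sym (negPf v_neq).
  - by rewrite eq_sym.
  by move: h2; rewrite orbb (negPf v_neq).
exists Y; split=> [x y xyE|x y xyE|].
- by rewrite edge // EU inE xyE orbT.
- by apply/eqP/negbFE; rewrite edge ?EU ?inE ?xyE // (disjointFr Edisj).
by rewrite inY /c big_geq.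
Qed.

(* Main.v *)
Require Import Defs.
From mathcomp Require Import all_boot all_order all_algebra perm zify ring.
Set Implicit Arguments.
Unset Strict Implicit.
Unset Printing Implicit Defensive.
Import GRing.Theory.
Local Open Scope ring_scope.

(* Follow the one vertex x that Theta carries along the circle of labels: it  *)
(* passes its non-neighbours, and when it meets a neighbour w, reflection and *)
(* refraction alike make w the carried vertex and leave x in the slot of w,   *)
(* refraction also reversing the direction. The other n - 1 vertices thus     *)
(* sit in n - 1 fixed slots. The carried vertices are v_n, v_1, v_2, ...,     *)
(* v_n, v_1, ..., the slots of successive meetings are cyclic of period       *)
(* n - 1, and the t-th carried vertex travels a_t steps if it lies in Y_1 and *)
(* n - 1 - a_t steps otherwise. After t meetings the configuration of slots   *)
(* recurs iff n and p divide t, and then the label recurs iff t is a multiple *)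
(* of n p n / gcd(n, mu); summing the steps up to there gives the orbit size. *)

(** Write N for the number of vertices, [n.+3] in the sections below. Carried vertices recur after N
    meetings, slots after N - 1. [Theta_pass] and [Theta_hit] show that [Theta] respects this
    bookkeeping, and [order_Theta] reduces the orbit size to the sum of [dwell] up to the first t >
    0 with [returns t]. That condition is arithmetic. The vertices force t = K N. The slots force p
    | t, hence p | K, because p divides N - 1 ([c_shift], [p_dvd]). The label then advances by -K mu
    modulo N, so N / gcd(N, mu) must divide K ([height_returns]). These two divisors of K are
    coprime, so the first return has K = p N / gcd(N, mu). As p and N are coprime, p N consecutive
    meetings pair each of the N signs once with each of the p gaps; hence the product form of
    [sum_dwell]. *)

Lemma natr_Zp_eq n s t :
  (s%:R == t%:R :> 'Z_n.+2) = (s == t %[mod n.+2])%N.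
Proof. by rewrite -val_eqE /= !Zp_nat. Qed.

(** * Slots, carried vertices and one step of [Theta] *)

Section Dynamics.

Variables (n : nat) (V : finType) (E Erefl Erefr : {set {set V}}).
Variables (v : 'Z_n.+3 -> V) (Y : {set V}) (c : nat -> 'Z_n.+2).
Hypothesis v_enum : cycle_enum E v.
Hypothesis E_split : E = Erefl :|: Erefr.
Hypothesis E_disj : [disjoint Erefl & Erefr].
Hypothesis Y_part : is_part1 Erefl Erefr (v 0) Y.
Hypothesis c_eq : forall s t, (c s == c t) = (s == t %[mod n.+2])%N.

Local Notation T := (@Theta n.+3 V Erefl Erefr).

Definition vertex (t : nat) : V := v t%:R.

Definition sign_at (t : nat) : bool := vertex t \in Y.

(* The label, relative to i, of a vertex whose slot is d above the slot next  *)
(* to be met, while Theta swaps or compares the labels i and i + 1 in         *)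
(* direction b; the carried vertex has label i if b, and i + 1 otherwise.     *)
Definition offset (b : bool) (d : 'Z_n.+2) : 'Z_n.+3 :=
  if d == 0 then (b : nat)%:R else (val d).+1%:R.

Lemma offset_true d : offset true d = (val d).+1%:R.
Proof. by rewrite /offset; case: eqP => // ->. Qed.

(** Moving i and the next slot together by one in direction b turns the labels just after a swap or
    comparison back into the form required by [at_phase]. *)
Lemma offset_shift b d :
  offset (~~ b) d = sgn_Zn n.+3 b + offset b (d - sgn_Zn n.+2 b).
Proof.
have dlt : (d < n.+2)%N := ltn_ord d.
have vE (x : 'Z_n.+2) : x != 0 -> (0 < x)%N.
  by move=> x0; rewrite lt0n; apply: contra x0 => /eqP x0; apply/eqP/val_inj.
have valB1 (x : 'Z_n.+2) : x != 0 -> (val (x - 1)).+1 = val x.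
  move=> /vE x0; have xlt : (x < n.+2)%N := ltn_ord x.
  rewrite /= [(1 %% _)%N]modn_small // modnDmr.
  by rewrite (_ : (x + (n.+2 - 1) = x.-1 + n.+2)%N) ?modnDr ?modn_small; lia.
have valN1 : (val (- 1 : 'Z_n.+2)).+1 = n.+2 by rewrite /= [(1 %% _)%N]modn_small // subn1 modn_small.
case: b; rewrite /sgn_Zn [~~ _]/=.
  rewrite offset_true /offset; have [->|d0] := eqVneq d 0; last by rewrite valB1 // nat1r.
  by rewrite sub0r valN1 nat1r; apply/eqP; rewrite (@natr_Zp_eq n.+1 0 n.+3) modnn mod0n.
rewrite offset_true opprK /offset addr_eq0; have [->|d1] := eqVneq d (- 1).
  rewrite valN1 addr0; apply/eqP.
  by rewrite -addr_eq0 natr1 (@natr_Zp_eq n.+1 n.+3 0) modnn mod0n.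
by rewrite -[in LHS](addrK 1 d) valB1 ?addr_eq0 // -[in RHS]natr1 [RHS]addrC addrK.
Qed.

(** Only the slot d = 0 is affected: it holds the one of i, i + 1 that the carried vertex does not
    have. *)
Lemma tperm_offset i b d :
  simple_transp i (i + offset b d) = i + offset (~~ b) d.
Proof.
rewrite /offset /simple_transp; have [_|d0] := eqVneq d 0.
  by case: b; rewrite ?addr0 ?tpermL ?tpermR.
have dlt : (val d < n.+2)%N := ltn_ord d.
have {d0} : (0 < val d)%N.
  by rewrite lt0n; apply: contra d0 => /eqP d0; apply/eqP/val_inj.
move: (val d) dlt => x xlt x0.
have neq (j : nat) : (j < 2)%N -> i + j%:R != i + x.+1%:R.
  by move=> j2; rewrite (inj_eq (@addrI _ i)) natr_Zp_inj //; lia.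
by rewrite tpermD //; [move: (neq 0%N isT); rewrite addr0 | apply: (neq 1%N isT)].
Qed.

(* [vertex t] is carried, c (t + j) is the slot of [vertex (t + j)], and k is *)
(* the slot next to be met.                                                   *)
Definition at_phase t i k (sigma : labeling n.+3 V) : Prop :=
  sigma (vertex t) = i + (~~ sign_at t : nat)%:R /\
  forall j, (0 < j < n.+3)%N ->
    sigma (vertex (t + j)) = i + offset (sign_at t) (c (t + j) - k).

Lemma vertex_eq s t : (vertex s == vertex t) = (s == t %[mod n.+3])%N.
Proof. by rewrite (bij_eq v_enum.1) natr_Zp_eq. Qed.

Lemma vertex_surj t w : w != vertex t ->
  exists2 j, (0 < j < n.+3)%N & w = vertex (t + j).
Proof.
have [g vK gK] := v_enum.1.
set d := g w - t%:R; have dlt : (d < n.+3)%N := ltn_ord d.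
have wE : w = vertex (t + d).
  by rewrite /vertex natrD natr_Zp addrC subrK gK.
move=> w_neq; exists d => //; rewrite dlt andbT lt0n.
by apply: contra w_neq => /eqP d0; rewrite wE d0 addn0.
Qed.

Lemma c_surj t k : exists2 j, (0 < j < n.+3)%N & c (t + j) = k.
Proof.
pose f (j : 'I_n.+2) := c (t + j.+1).
have f_inj : injective f.
  move=> x y /eqP; rewrite c_eq !addnS -!addSn eqn_modDl !modn_small // => /eqP.
  exact: val_inj.
have [g _ gK] := injF_bij f_inj.
by exists (g k).+1; [rewrite /= ltnS | apply: gK].
Qed.

Lemma adjacent t j : (0 < j < n.+3)%N ->
  ([set vertex t; vertex (t + j)] \in E) = (j == 1%N) || (j == n.+2).
Proof.
have [v_bij ->] := v_enum; move=> jP.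
have vtx_eq (s : nat) k : (vertex s == v k) = (s%:R == k) by rewrite (bij_eq v_bij).
apply/imsetP/orP => [[k _ eE]|[/eqP ->|/eqP ->]]; last 2 first.
- by exists t%:R; rewrite // natr1 addn1.
- exists (t + n.+2)%:R; rewrite // setUC; congr [set _; v _].
  by apply/eqP; rewrite natr1 natr_Zp_eq -addnS addnC modnDl.
have : vertex t \in [set v k; v (k + 1)] by rewrite -eE !inE eqxx.
have : vertex (t + j) \in [set v k; v (k + 1)] by rewrite -eE !inE eqxx orbT.
rewrite !inE !vtx_eq; have [->|_] := eqVneq k t%:R.
  rewrite natr1 !natr_Zp_eq -[X in _ == X %[mod _]]addn0 -[t.+1]addn1 !eqn_modDl.
  by move=> + _; rewrite !modn_small; lia.
move=> tjE /= /eqP kE; move: tjE; rewrite -kE => /orP[/eqP kj|].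
  move/eqP: kE; rewrite -kj natr1 natr_Zp_eq.
  rewrite -addnS -[X in X == _ %[mod _]]addn0 !eqn_modDl mod0n.
  have [|] := ltnP j.+1 n.+3; first by move=> jlt; rewrite !modn_small; lia.
  by lia.
by rewrite natr_Zp_eq -[X in _ == X %[mod _]]addn0 !eqn_modDl mod0n modn_small; lia.
Qed.

(** Consecutive carried vertices are adjacent, and they lie in different parts exactly at a
    refraction; so the direction can be read off from Y. *)
Lemma sign_hit t :
  if [set vertex t; vertex t.+1] \in Erefl then sign_at t.+1 = sign_at t
  else [set vertex t; vertex t.+1] \in Erefr /\ sign_at t.+1 = ~~ sign_at t.
Proof.
have [refr refl _] := Y_part.
have : [set vertex t; vertex t.+1] \in E by rewrite -[t.+1]addn1 adjacent.
rewrite E_split inE; case: ifP => [eL _|_ /= eR]; first exact/esym/refl.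
by split=> //; have := refr _ _ eR; rewrite /sign_at; do 2!case: (_ \in Y).
Qed.

Lemma phase_preim t i k sigma j :
  at_phase t i k sigma -> (0 < j < n.+3)%N -> c (t + j) = k ->
  sigma @^-1: [set i; i + 1] = [set vertex t; vertex (t + j)].
Proof.
move=> [s0 sj] jP cj; apply/setP => w; rewrite !inE.
have := sj j jP; rewrite cj subrr /offset eqxx => sjE.
rewrite -!(inj_eq (bij_inj (labeling_bij sigma)) w) s0 sjE.
by case: (sign_at t); rewrite /= ?addr0 // orbC.
Qed.

(* Its hypotheses describe the labelling right after the swap or comparison,  *)
(* in terms of the new carried vertex and direction.                          *)
Lemma phase_shift t i k (sigma : labeling n.+3 V) :
  sigma (vertex t) = i + (sign_at t : nat)%:R ->
  (forall j, (0 < j < n.+3)%N ->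
    sigma (vertex (t + j)) = i + offset (~~ sign_at t) (c (t + j) - k)) ->
  at_phase t (i + sgn_Zn n.+3 (sign_at t)) (k + sgn_Zn n.+2 (sign_at t)) sigma.
Proof.
move=> s0 sj; split=> [|j jP].
  by rewrite s0; case: (sign_at t); rewrite /= ?addr0 ?subrK.
by rewrite sj // offset_shift addrA opprD !addrA.
Qed.

(** The neighbours of [vertex t] are [vertex t.+1], in slot [c t.+1], and [vertex (t + n.+2)], in
    slot [c t]; every other slot holds a non-neighbour. *)
Lemma Theta_pass t i k sigma :
  at_phase t i k sigma -> k != c t -> k != c t.+1 ->
  exists2 sigma', T (sigma, i, sign_at t) =
      (sigma', i + sgn_Zn n.+3 (sign_at t), sign_at t)
    & at_phase t (i + sgn_Zn n.+3 (sign_at t)) (k + sgn_Zn n.+2 (sign_at t))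
        sigma'.
Proof.
move=> ph kc kc1; have [j jP cj] := c_surj t k.
have /negP eE : ~~ (sigma @^-1: [set i; i + 1] \in E).
  rewrite (phase_preim ph jP cj) adjacent //.
  apply/norP; split; apply/eqP => j1; subst j.
    by rewrite -cj addn1 eqxx in kc1.
  by rewrite -cj c_eq addnC modnDl eqxx in kc.
have [eL eR] : sigma @^-1: [set i; i + 1] \notin Erefl /\
    sigma @^-1: [set i; i + 1] \notin Erefr.
  by split; apply/negP => e; apply: eE; rewrite E_split inE e ?orbT.
exists (perm_labeling (simple_transp i) sigma).
  by rewrite /Theta (negPf eL) (negPf eR).
have [s0 sj] := ph.
apply: phase_shift => [|j' j'P]; rewrite perm_labelingE ?sj ?s0 //.
  by case: (sign_at t); rewrite /simple_transp /= ?addr0 ?tpermL ?tpermR.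
by rewrite tperm_offset.
Qed.

(** The vertex left behind is [vertex (t.+1 + n.+2)], the last one of the new window; as c has
    period N - 1, its slot is that of the vertex just met. *)
Lemma Theta_hit t i k sigma :
  at_phase t i k sigma -> k = c t.+1 ->
  exists2 sigma', T (sigma, i, sign_at t) =
      (sigma', i + sgn_Zn n.+3 (sign_at t.+1), sign_at t.+1)
    & at_phase t.+1 (i + sgn_Zn n.+3 (sign_at t.+1))
        (k + sgn_Zn n.+2 (sign_at t.+1)) sigma'.
Proof.
move=> ph kE; have j1 : (0 < 1 < n.+3)%N by [].
have [s0 sj] := ph.
have ct : c (t + 1) = k by rewrite addn1 kE.
have eE := phase_preim ph j1 ct; rewrite addn1 in eE.
have := sign_hit t; rewrite -eE.
have s1 : sigma (vertex t.+1) = i + (sign_at t : nat)%:R.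
  by have := sj 1%N j1; rewrite addn1 -kE subrr /offset eqxx.
have lastE : vertex (t.+1 + n.+2) = vertex t.
  by apply/eqP; rewrite vertex_eq addSnnS addnC modnDl.
have clastE : c (t.+1 + n.+2) = k.
  by rewrite kE; apply/eqP; rewrite c_eq addnC modnDl.
have jcase j : (0 < j < n.+3)%N -> j = n.+2 \/ (0 < j.+1 < n.+3)%N.
  by move=> jP; case: (eqVneq j n.+2) => [|jn]; [left | right]; lia.
have off j : (0 < j < n.+3)%N -> j != n.+2 -> c (t.+1 + j) - k != 0.
  move=> jP jn; rewrite subr_eq0 kE c_eq -[X in _ == X %[mod _]]addn0 eqn_modDl.
  by rewrite mod0n modn_small //; lia.
(* Away from slot k the offset ignores the direction, which a refraction flips. *)
have offE b b' j : (0 < j < n.+3)%N -> j != n.+2 ->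
    offset b (c (t.+1 + j) - k) = offset b' (c (t.+1 + j) - k).
  by move=> jP jn; rewrite /offset (negPf (off _ jP jn)).
case: ifP => eL.
  move=> sE; exists sigma; first by rewrite /Theta eL sE.
  apply: phase_shift => [|j jP]; first by rewrite sE s1.
  have [jn|jn] := eqVneq j n.+2.
    by rewrite jn lastE clastE s0 sE subrr /offset eqxx.
  by rewrite addSnnS sj -?addSnnS; [rewrite (offE _ (~~ sign_at t.+1)) | lia].
move=> [eR sE]; exists (perm_labeling (simple_transp i) sigma).
  by rewrite /Theta eL eR sE /sgn_Zn; case: (sign_at t); rewrite /= ?opprK.
apply: phase_shift => [|j jP]; rewrite perm_labelingE.
  by rewrite s1 sE; case: (sign_at t); rewrite /simple_transp /= ?addr0 ?tpermL ?tpermR.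
have [jn|jn] := eqVneq j n.+2.
  rewrite jn lastE clastE s0 sE subrr /offset eqxx.
  by case: (sign_at t); rewrite /simple_transp /= ?addr0 ?tpermL ?tpermR.
rewrite addSnnS sj -?addSnnS ?tperm_offset; last by lia.
by rewrite (offE _ (~~ sign_at t.+1)).
Qed.

(** * Travel between meetings *)

Lemma offset_inj b : injective (offset b).
Proof.
have true_inj : injective (offset true).
  move=> x y.
  have xlt : (val x < n.+2)%N := ltn_ord x.
  have ylt : (val y < n.+2)%N := ltn_ord y.
  move=> /eqP; rewrite !offset_true natr_Zp_inj // eqSS => /eqP; exact: val_inj.
case: b => // x y; rewrite -[false]/(~~ true) !offset_shift.
by move=> /addrI /true_inj /addIr.
Qed.

(** The number of steps during which [vertex t] is carried. *)
Definition dwell t : nat := val (sgn_Zn n.+2 (sign_at t) * (c t.+1 - c t)).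

Lemma sgn_Zn_sqr N b : sgn_Zn N b * sgn_Zn N b = 1.
Proof. by case: b; rewrite /sgn_Zn ?mulr1 // mulrNN mulr1. Qed.

Lemma dwell_bound t : (0 < dwell t < n.+2)%N.
Proof.
have dlt : (dwell t < n.+2)%N := ltn_ord _.
rewrite dlt andbT lt0n; apply/negP => /eqP d0.
have : sgn_Zn n.+2 (sign_at t) * (c t.+1 - c t) == 0 by apply/eqP/val_inj.
rewrite -(mulr0 (sgn_Zn n.+2 (sign_at t))).
move=> /eqP/(congr1 ( *%R (sgn_Zn n.+2 (sign_at t)))) /eqP.
rewrite !mulrA sgn_Zn_sqr !mul1r subr_eq0 c_eq -addn1 -[X in _ == X %[mod _]]addn0.
by rewrite eqn_modDl !modn_small.
Qed.

Lemma cS t : c t.+1 = c t + sgn_Zn n.+2 (sign_at t) *+ dwell t.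
Proof.
by rewrite -mulr_natr /dwell natr_Zp mulrA sgn_Zn_sqr mul1r addrC subrK.
Qed.

Variable h0 : 'Z_n.+3.

(* The value of the component i at the t-th meeting, continued back to t = 0. *)
Definition height t : 'Z_n.+3 :=
  h0 + \sum_(0 <= l < t) sgn_Zn n.+3 (sign_at l) *+ dwell l.

Lemma heightS t : height t.+1 = height t + sgn_Zn n.+3 (sign_at t) *+ dwell t.
Proof. by rewrite /height big_nat_recr //= addrA. Qed.

(** Here s runs from 1 to [dwell t]: s = 0 would point at slot [c t], just left behind, and at s =
    [dwell t] the next meeting is due. *)
Definition reached t s (x : state n.+3 V) : Prop :=
  [/\ x.2 = sign_at t, x.1.2 = height t + sgn_Zn n.+3 (sign_at t) *+ s
    & at_phase t x.1.2 (c t + sgn_Zn n.+2 (sign_at t) *+ s) x.1.1].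

Lemma reached_Theta t s x : (0 < s <= dwell t)%N -> reached t s x ->
  if (s < dwell t)%N then reached t s.+1 (T x) else reached t.+1 1 (T x).
Proof.
case: x => [[sigma i] e] sP [eE iE ph].
rewrite /= in eE iE ph; rewrite {}eE.
have dB := dwell_bound t; have cSt := cS t.
have kdiff s' : (s' < s)%N || (s < s' <= dwell t)%N ->
   c t + sgn_Zn n.+2 (sign_at t) *+ s != c t + sgn_Zn n.+2 (sign_at t) *+ s'.
  move=> s'P; rewrite (inj_eq (@addrI _ _)) -[_ *+ s]mulr_natr -[_ *+ s']mulr_natr.
  apply/negP => /eqP/(congr1 ( *%R (sgn_Zn n.+2 (sign_at t)))) /eqP.
  by rewrite !mulrA sgn_Zn_sqr !mul1r natr_Zp_eq !modn_small; lia.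
case: ltnP => sd.
  have [||sigma' -> ph'] := Theta_pass ph.
  - by have := kdiff 0%N; rewrite addr0; apply; lia.
  - by rewrite cSt kdiff; lia.
  by split=> //=; rewrite mulrSr addrA // iE.
have sE : s = dwell t by lia.
rewrite sE -cSt in ph; have [//|sigma' -> ph'] := Theta_hit ph.
by split=> //=; rewrite ?iE ?sE ?heightS.
Qed.

Lemma sum_dwell_leq t t' : (t <= t')%N ->
  (\sum_(0 <= l < t) dwell l <= \sum_(0 <= l < t') dwell l)%N.
Proof. by move=> tt'; rewrite [leqRHS](big_cat_nat (leq0n t) tt') leq_addr. Qed.

(** * Returns to the initial state *)

Section Start.

Variables (s0 : nat) (x0 : state n.+3 V).
Hypothesis s0P : (0 < s0 <= dwell 0)%N.
Hypothesis x0P : reached 0 s0 x0.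

Lemma reached_iter k : exists t s,
  [/\ (0 < s <= dwell t)%N, (k + s0 = \sum_(0 <= l < t) dwell l + s)%N
    & reached t s (iter k T x0)].
Proof.
elim: k => [|k [t [s [sP kE r]]]]; first by exists 0%N, s0; rewrite big_nil.
have := reached_Theta sP r; case: ifP => sd r'.
  by exists t, s.+1; split=> //; lia.
exists t.+1, 1%N; have := dwell_bound t.+1; split=> //; first by lia.
by rewrite big_nat_recr //=; lia.
Qed.

(** Slots matter only up to a common rotation, since [at_phase] sees c only through differences with
    the next slot. *)
Definition returns t : Prop :=
  [/\ (n.+3 %| t)%N, forall j, c (t + j) - c t = c j - c 0 & height t = h0].

Lemma reached_returns t s :
  (0 < s <= dwell t)%N -> reached t s x0 -> s = s0 /\ returns t.
Proof.
case: x0 x0P => [[sigma i] e] [/= e0 i0 [p0 pj]] sP [/= et it [qt qj]].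
have sE : sign_at t = sign_at 0 by rewrite -e0 -et.
have t_dvd : (n.+3 %| t)%N.
  rewrite /dvdn -(mod0n n.+3) -vertex_eq -(bij_eq (labeling_bij sigma)).
  by rewrite p0 qt sE.
have vtj j : vertex (t + j) = vertex (0 + j).
  by apply/eqP; rewrite vertex_eq eqn_modDr mod0n.
have cj j : (0 < j < n.+3)%N ->
    c (t + j) - (c t + sgn_Zn n.+2 (sign_at t) *+ s) =
    c (0 + j) - (c 0 + sgn_Zn n.+2 (sign_at 0) *+ s0).
  move=> jP; have := pj j jP; rewrite -vtj (qj j jP) sE => /addrI.
  exact: offset_inj.
have cM j : c (j + n.+2) = c j by apply/eqP; rewrite c_eq modnDr.
(* At j = N - 1 the slot is [c t] itself, which isolates s; both s and s0 are below N - 1. *)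
have ss0 : s = s0.
  have /cj : (0 < n.+2 < n.+3)%N by rewrite ltnS leqnn.
  rewrite !cM.
  rewrite !opprD !addrA !subrr !add0r sE -[_ *+ s]mulr_natr -[_ *+ s0]mulr_natr => /oppr_inj.
  move=> /(congr1 ( *%R (sgn_Zn n.+2 (sign_at 0)))) /eqP.
  have d0P := dwell_bound 0; have dtP := dwell_bound t.
  by rewrite !mulrA sgn_Zn_sqr !mul1r natr_Zp_eq !modn_small; lia.
split=> //; split=> // [j|].
  (* Only 0 < j < N is available, so the residue 0 modulo N - 1 is represented by N - 1. *)
  have [j' j'P cjj'] : exists2 j', (0 < j' < n.+3)%N & forall t', c (t' + j) = c (t' + j').
    exists (j %% n.+2 + n.+2 * (j %% n.+2 == 0))%N.
      by have := ltn_pmod j (ltn0Sn n.+1); case: eqP => /=; lia.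
    move=> t'; apply/eqP; rewrite c_eq eqn_modDl mulnC addnC modnMDl.
    by rewrite modn_mod.
  have := cj j' j'P; rewrite -!cjj' sE ss0 !opprD !addrA add0n => /addIr //.
move: it; rewrite i0 sE ss0 => /addIr <-.
by rewrite /height big_nil addr0.
Qed.

Lemma returns_reached t x :
  returns t -> reached t s0 x -> x = x0.
Proof.
case: x x0 x0P => [[sigma i] e] [[sigma0 i0] e0] [/= eE0 iE0 [p0 pj]].
move=> [t_dvd ct ht] [/= eE iE [qt qj]].
have vtj j : vertex (t + j) = vertex j.
  by apply/eqP; rewrite vertex_eq -[X in _ == X %[mod _]]add0n eqn_modDr mod0n.
have sE : sign_at t = sign_at 0 by rewrite /sign_at -[t]addn0 vtj.
have ii : i = i0 by rewrite iE iE0 ht sE /height big_nil addr0.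
rewrite eE eE0 sE ii; congr (_, _, _) => //.
  apply: labeling_eq => w.
  have [->|w0] := eqVneq w (vertex 0).
    by rewrite p0 -[in LHS]vtj addn0 qt sE ii.
  have [j jP ->] := vertex_surj w0.
  rewrite pj // -[in LHS]vtj add0n qj // sE ii; congr (_ + offset _ _).
  by rewrite !opprD !addrA ct.
Qed.

(** Each iterate of x0 sits at a pair (t, s), located by comparing partial sums of [dwell]. As
    [dwell t0 = dwell 0], s0 is admissible at t0, so the full sum lands on (t0, s0), which is x0;
    conversely every return sits at some (t, s0) with [returns t]. *)
Lemma order_Theta t0 : (0 < t0)%N -> returns t0 -> dwell t0 = dwell 0 ->
  (forall t, (0 < t)%N -> returns t -> (t0 <= t)%N) ->
  fingraph.order T x0 = (\sum_(0 <= l < t0) dwell l)%N.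
Proof.
move=> t0_gt0 ret0 dw0 t0_min; set k := (\sum_(0 <= l < t0) dwell l)%N.
have k_gt0 : (0 < k)%N.
  have := sum_dwell_leq t0_gt0; rewrite big_nat1.
  by have := dwell_bound 0; lia.
apply/eqP; rewrite eqn_leq; apply/andP; split.
  have [t [s [sP kE r]]] := reached_iter k.
  have tE : t = t0.
    have dS t' : (\sum_(0 <= l < t'.+1) dwell l =
        \sum_(0 <= l < t') dwell l + dwell t')%N by rewrite big_nat_recr.
    case: (ltngtP t t0) => // /sum_dwell_leq; rewrite -/k dS; first by lia.
    by rewrite -/k dw0; lia.
  have sE : s = s0 by rewrite tE -/k in kE; lia.
  rewrite tE sE in r; have xE := returns_reached ret0 r.
  (* Below the order, [findex] would recover k > 0, but at x0 it is 0. *)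
  rewrite leqNgt; apply/negP => /findex_iter; rewrite xE findex0.
  by lia.
have [t [s [sP kE]]] := reached_iter (fingraph.order T x0).
rewrite iter_order; last exact: Theta_inj.
move=> /(reached_returns sP) [ss0 rt]; have oE : fingraph.order T x0 = (\sum_(0 <= l < t) dwell l)%N by lia.
rewrite oE; apply: sum_dwell_leq; apply: t0_min => //.
by case: t oE {sP kE rt} => //; rewrite big_nil => o0; have := order_gt0 T x0; lia.
Qed.

End Start.

End Dynamics.

(** * Sums of periodic sequences *)

Lemma periodic_mul (T : Type) (f : nat -> T) N q b :
  (forall l, f (l + N)%N = f l) -> f (b + q * N)%N = f b.
Proof.
by move=> fN; elim: q => [|q IH]; rewrite ?addn0 // mulSnr addnA fN.
Qed.

Lemma sum_periodic (f : nat -> nat) N q : (forall l, f (l + N)%N = f l) ->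
  (\sum_(0 <= l < q * N) f l = q * \sum_(0 <= l < N) f l)%N.
Proof.
move=> fN; elim: q => [|q IH]; first by rewrite big_nil.
rewrite !mulSn -IH (big_cat_nat (leq0n N)) ?leq_addr //=; congr (_ + _)%N.
rewrite -[X in \sum_(X <= _ < _) _]add0n big_addn addKn.
by apply: eq_big_nat => l _; rewrite fN.
Qed.

Lemma sum_periodic_shift (f : nat -> nat) p i : (forall l, f (l + p)%N = f l) ->
  (\sum_(0 <= l < p) f (l + i) = \sum_(0 <= l < p) f l)%N.
Proof.
move=> fp; elim: i => [|i <-]; first by apply: eq_big_nat => l _; rewrite addn0.
case: p fp => [|p] fp; first by rewrite !big_nil.
rewrite big_nat_recr // [RHS]big_nat_recl //= [LHS]addnC; congr (_ + _)%N.
  by rewrite -[RHS]fp; congr f; lia.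
by apply: eq_big_nat => l _; rewrite addnS.
Qed.

(* As [N = 1 %[mod p]], the arithmetic progression of step [N] starting at    *)
(* [i] visits the residues mod [p] in their natural order.                    *)
Lemma sum_mul_periodic (s a : nat -> nat) N p q :
  (forall l, s (l + N)%N = s l) -> (forall l, a (l + p)%N = a l) ->
  (p %| N.-1)%N -> (0 < N)%N ->
  (\sum_(0 <= l < q * p * N) s l * a l =
   q * (\sum_(0 <= l < N) s l) * \sum_(0 <= l < p) a l)%N.
Proof.
move=> sN ap /dvdnP[d dE] N0.
have NE : N = (d * p).+1 by lia.
have aN j i : a (j * N + i)%N = a (j + i)%N.
  by rewrite NE mulnS -(periodic_mul (j * d) (j + i) ap); congr a; ring.
rewrite big_nat_mul.
transitivity (\sum_(0 <= j < q * p) \sum_(0 <= i < N) s i * a (j + i))%N.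
  apply: eq_big_nat => j _; rewrite -[X in \sum_(X <= _ < _) _]add0n big_addn.
  rewrite mulSn addnK; apply: eq_big_nat => i _.
  by rewrite (periodic_mul j i sN) [(i + _)%N]addnC aN.
rewrite exchange_big /=.
transitivity (\sum_(0 <= i < N) s i * (q * \sum_(0 <= l < p) a l))%N.
  apply: eq_big_nat => i _; rewrite -big_distrr /=; congr (_ * _)%N.
  have ap' l : a (l + p + i)%N = a (l + i)%N by rewrite addnAC ap.
  by rewrite (sum_periodic q ap') (sum_periodic_shift i ap).
by rewrite -big_distrl /=; ring.
Qed.

Lemma min_period_dvdn (a : nat -> nat) p t :
  is_min_period a p -> (forall b, a (b + t)%N = a b) -> (p %| t)%N.
Proof.
move=> [[p0 ap] p_min] at_.
rewrite /dvdn eqn0Ngt; apply/negP => r0.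
have /p_min : is_period a (t %% p).
  split=> // b; rewrite -(periodic_mul (t %/ p) _ ap) -addnA.
  by rewrite [(t %% p + _)%N]addnC -divn_eq at_.
by rewrite leqNgt ltn_mod p0.
Qed.

(** * Arithmetic of return times and total travel *)

Section Counting.

Variables (n : nat) (V : finType) (E : {set {set V}}).
Variables (v : 'Z_n.+3 -> V) (Y : {set V}) (c : nat -> 'Z_n.+2).
Variables (m p : nat).
Hypothesis v_enum : cycle_enum E v.
Hypothesis c_eq : forall s t, (c s == c t) = (s == t %[mod n.+2])%N.

(** The upward gap between successive slots; for the slots of the given labelling it is the sequence
    a ([aseqE]). *)
Definition rise t : nat := val (c t.+1 - c t).

Hypothesis sum_rise : (\sum_(0 <= l < n.+2) rise l = m * n.+2)%N.
Hypothesis p_min : is_min_period rise p.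

Local Notation mu := #|Y|.
Local Notation sgn := (sign_at v Y).
Local Notation r := (n.+3 %/ gcdn n.+3 mu)%N.

Lemma rise_lt t : (rise t < n.+2)%N.
Proof. exact: ltn_ord. Qed.

Lemma rise_gt0 t : (0 < rise t)%N.
Proof.
rewrite lt0n; apply/negP => /eqP r0.
have : c t.+1 - c t == 0 by apply/eqP/val_inj.
rewrite subr_eq0 c_eq -addn1 -[X in _ == X %[mod _]]addn0.
by rewrite eqn_modDl !modn_small.
Qed.

Lemma riseE t : c t.+1 = c t + (rise t)%:R.
Proof. by rewrite /rise natr_Zp addrC subrK. Qed.

Lemma c_shift t :
  (forall j, c (t + j) - c t = c j - c 0) <-> (forall j, rise (j + t) = rise j).
Proof.
split=> [ct j|rt j].
  have cE i : c (t + i) = c i + (c t - c 0).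
    by rewrite -(subrK (c t) (c (t + i))) ct; ring.
  by rewrite /rise addnC -addnS !cE opprD addrACA subrr addr0.
elim: j => [|j IH]; first by rewrite addn0 !subrr.
by rewrite addnS !riseE addnC rt addrAC [(j + t)%N]addnC IH; ring.
Qed.

Lemma rise_period t : rise (t + n.+2) = rise t.
Proof. by apply c_shift => j; congr (_ - _); apply/eqP; rewrite c_eq ?modnDl ?modnn. Qed.

Lemma p_dvd : (p %| n.+2)%N.
Proof. by apply: (min_period_dvdn p_min); exact: rise_period. Qed.

Lemma rise_p t : rise (t + p) = rise t.
Proof. by case: p_min => -[]. Qed.

(** m is the mean of [rise] over N - 1 terms, which form a whole number of periods. *)
Lemma sum_rise_p : (\sum_(0 <= l < p) rise l = m * p)%N.
Proof.
have [d dE] := dvdnP p_dvd; have p0 : (0 < p)%N by case: p_min => -[].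
have := sum_rise; rewrite dE (sum_periodic _ rise_p) => eqS.
have d0 : (0 < d)%N by case: d dE {eqS}.
by apply/eqP; rewrite -(eqn_pmul2l d0) eqS; apply/eqP; ring.
Qed.

Lemma m_le : (m <= n.+2)%N.
Proof.
have p0 : (0 < p)%N by case: p_min => -[].
rewrite -(leq_pmul2r p0) -sum_rise_p mulnC -[X in (X * _)%N]subn0 -sum_nat_const_nat.
by apply: leq_sum => l _; exact/ltnW/rise_lt.
Qed.

Lemma sign_period t : sgn (t + n.+3) = sgn t.
Proof.
by rewrite /sign_at; congr (_ \in Y); apply/eqP; rewrite (vertex_eq v_enum) modnDr.
Qed.

Lemma sum_sign : (\sum_(0 <= l < n.+3) sgn l = mu)%N.
Proof.
rewrite big_mkord.
transitivity (\sum_(i : 'Z_n.+3) (v i \in Y))%N.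
  by apply: eq_bigr => i _; rewrite /sign_at /vertex natr_Zp.
rewrite -sum1_card [RHS]big_mkcond /= (reindex v) /=; last exact/onW_bij/v_enum.1.
by apply: eq_bigr => i _; case: (_ \in Y).
Qed.

Lemma mu_le : (mu <= n.+3)%N.
Proof.
rewrite -sum_sign -[X in (_ <= X)%N]muln1 -[X in (_ <= X * 1)%N]subn0 -sum_nat_const_nat.
by apply: leq_sum => l _; case: sgn.
Qed.

Lemma sum_signN : (\sum_(0 <= l < n.+3) ~~ sgn l = n.+3 - mu)%N.
Proof.
have : (\sum_(0 <= l < n.+3) (sgn l + ~~ sgn l) = n.+3)%N.
  rewrite -[RHS]muln1 -[X in (_ = X * 1)%N]subn0 -sum_nat_const_nat.
  by apply: eq_bigr => l _; case: sgn.
by rewrite big_split /= sum_sign; lia.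
Qed.

Lemma dwellE l :
  dwell v Y c l = (sgn l * rise l + ~~ sgn l * (n.+2 - rise l))%N.
Proof.
rewrite /dwell /sgn_Zn -/(sign_at v Y l); case: (sgn l).
  by rewrite !mul1r mul1n mul0n addn0.
rewrite mulN1r mul0n mul1n add0n.
have := rise_gt0 l; rewrite /rise; move: (c l.+1 - c l) => x x0.
by rewrite /= modn_small // ltn_subrL x0.
Qed.

(** Slots live modulo N - 1 but labels modulo N: going down N - 1 - a labels is going up a + 1. *)
Lemma sgn_dwell l :
  sgn_Zn n.+3 (sgn l) *+ dwell v Y c l = (rise l + ~~ sgn l)%:R.
Proof.
rewrite dwellE /sgn_Zn; case: (sgn l).
  by rewrite mul1n mul0n !addn0.
rewrite mul0n mul1n add0n addn1 mulNrn.
apply/eqP; rewrite eq_sym -addr_eq0 -natrD.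
have rl := rise_lt l; rewrite (_ : _ + _ = n.+3)%N; last by lia.
by rewrite (@natr_Zp_eq n.+1 n.+3 0) modnn mod0n.
Qed.

(** Over K N meetings the gaps add up to a multiple of N, so only the extra 1 of each downward
    journey counts: K (N - mu) in all. *)
Lemma height_returns h0 K : (p %| K)%N ->
  height v Y c h0 (K * n.+3) = h0 <-> (r %| K)%N.
Proof.
move=> /dvdnP[q KE].
have signN_period t : (~~ sgn (t + n.+3) = ~~ sgn t :> nat)%N by rewrite sign_period.
have sumE : (\sum_(0 <= l < K * n.+3) (rise l + ~~ sgn l) =
    q * n.+3 * (m * p) + K * (n.+3 - mu))%N.
  rewrite big_split /= (sum_periodic K signN_period) sum_signN; congr (_ + _)%N.
  rewrite KE; have := @sum_mul_periodic (fun=> 1%N) rise n.+3 p q.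
  rewrite sum_nat_const_nat subn0 muln1 sum_rise_p => <- //; last exact: p_dvd.
    by apply: eq_bigr => l _; rewrite mul1n.
  exact: rise_p.
have g0 : (0 < gcdn n.+3 mu)%N by rewrite gcdn_gt0.
rewrite /height (eq_bigr _ (fun l _ => sgn_dwell l)) -natr_sum sumE.
set X := (_ + _)%N; have XE : (X + K * mu = n.+3 * (q * (m * p) + K))%N.
  by rewrite /X -addnA -mulnDr subnK ?mu_le //; ring.
(* Multiplied by gcd(N, mu), r | K becomes N | gcd(K N, K mu), that is N | K mu; and X = -K mu
   modulo N. *)
have -> : (r %| K)%N = (n.+3 %| X)%N.
  rewrite -(dvdn_pmul2r g0) divnK ?dvdn_gcdl // muln_gcdr dvdn_gcd (dvdn_mull _ (dvdnn _)) /=.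
  have : (n.+3 %| X + K * mu)%N by rewrite XE dvdn_mulr.
  by move=> XN; apply/idP/idP => dv; move: XN; [rewrite dvdn_addl | rewrite dvdn_addr].
have -> : (n.+3 %| X)%N = (X%:R == 0 :> 'Z_n.+3).
  by rewrite (@natr_Zp_eq n.+1 X 0) mod0n.
rewrite -[X in _ + _ = X]addr0.
by split=> [/addrI -> //|/eqP ->].
Qed.

Lemma sum_dwell q :
  (\sum_(0 <= l < q * p * n.+3) dwell v Y c l =
   q * p * (mu * m + (n.+3 - mu) * (n.+2 - m)))%N.
Proof.
rewrite (eq_bigr _ (fun l _ => dwellE l)) big_split /=.
have N0 : (0 < n.+3)%N by [].
have s_per l : (sgn (l + n.+3) = sgn l :> nat)%N by rewrite sign_period.
have sN_per l : (~~ sgn (l + n.+3) = ~~ sgn l :> nat)%N by rewrite sign_period.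
have aN_per l : (n.+2 - rise (l + p) = n.+2 - rise l)%N by rewrite rise_p.
rewrite (sum_mul_periodic q s_per rise_p p_dvd N0).
rewrite (sum_mul_periodic q sN_per aN_per p_dvd N0).
rewrite sum_sign sum_signN sum_rise_p.
have -> : (\sum_(0 <= l < p) (n.+2 - rise l) = (n.+2 - m) * p)%N.
  have : (\sum_(0 <= l < p) ((n.+2 - rise l) + rise l) = p * n.+2)%N.
    rewrite -[X in (X * _)%N]subn0 -sum_nat_const_nat.
    by apply: eq_bigr => l _; rewrite subnK // ltnW ?rise_lt.
  by rewrite big_split /= sum_rise_p mulnBl; lia.
by ring.
Qed.

End Counting.

(** * Slots of the given labelling *)

Section InitialState.

Variables (n : nat) (V : finType) (E : {set {set V}}).
Variables (sigma : labeling n.+3 V) (v : 'Z_n.+3 -> V).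
Hypothesis nv : naming E sigma v.

(* The representative of t modulo n - 1 in {1, ..., n - 1}, omitting v_n.     *)
Definition cycle_index (t : nat) : 'Z_n.+3 :=
  if (t %% n.+2)%N == 0%N then - 1 else (t %% n.+2)%:R.

Definition level (t : nat) : nat := val (sigma (v (cycle_index t)) - 1).

(** Levels fill 1, ..., N - 1, a full set of residues modulo N - 1, since level 0 belongs to v_n. *)
Definition circle_pos (t : nat) : 'Z_n.+2 := (level t)%:R.

Lemma oppr1_Zp : - 1 = n.+2%:R :> 'Z_n.+3.
Proof.
by apply/eqP; rewrite eq_sym -addr_eq0 natr1 (@natr_Zp_eq n.+1 n.+3 0) modnn mod0n.
Qed.

Lemma cycle_index_small j : (0 < j < n.+3)%N -> cycle_index j = j%:R.
Proof.
rewrite /cycle_index; have [->|jn] := eqVneq j n.+2; first by rewrite modnn oppr1_Zp.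
by move=> jP; rewrite modn_small; [case: eqP => // j0; lia | lia].
Qed.

Lemma cycle_index_eq s t :
  (cycle_index s == cycle_index t) = (s == t %[mod n.+2])%N.
Proof.
have idxE u : cycle_index u = (if u %% n.+2 == 0 then n.+2 else u %% n.+2)%N%:R.
  by rewrite /cycle_index oppr1_Zp; case: ifP.
have := ltn_pmod s (ltn0Sn n.+1); have := ltn_pmod t (ltn0Sn n.+1).
rewrite !idxE; move: (s %% _)%N (t %% _)%N => x y ylt xlt.
by case: (x =P 0%N) => x0; case: (y =P 0%N) => y0; rewrite natr_Zp_inj; lia.
Qed.

Lemma cycle_index_neq0 t : cycle_index t != 0.
Proof.
have := ltn_pmod t (ltn0Sn n.+1); rewrite /cycle_index; case: ifP => [_ _|/eqP t0 tlt].
  by rewrite oppr_eq0 oner_eq0.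
by rewrite (@natr_Zp_inj n _ 0) //; lia.
Qed.

Lemma sv_eq x y : (sigma (v x) == sigma (v y)) = (x == y).
Proof.
have [[v_bij _] _ _] := nv.
by rewrite (bij_eq (labeling_bij sigma)) (bij_eq v_bij).
Qed.

Lemma sv_neq1 t : sigma (v (cycle_index t)) != 1.
Proof. by have [_ <- _] := nv; rewrite sv_eq cycle_index_neq0. Qed.

Lemma level_bound t : (0 < level t < n.+3)%N.
Proof.
rewrite /level (ltn_ord _) andbT lt0n; apply: contra (sv_neq1 t) => /eqP l0.
by rewrite -subr_eq0; apply/eqP/val_inj.
Qed.

Lemma circle_pos_eq s t : (circle_pos s == circle_pos t) = (s == t %[mod n.+2])%N.
Proof.
rewrite -cycle_index_eq -sv_eq -(inj_eq (can_inj (subrK (1 : 'Z_n.+3)))).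
have := level_bound s; have := level_bound t.
rewrite -[in RHS]val_eqE -/(level s) -/(level t) /circle_pos natr_Zp_eq.
case: (level s) (level t) => [|x] [|y] // yP xP.
by rewrite -[x.+1]addn1 -[y.+1]addn1 !eqn_modDr eqn_add2r !modn_small; lia.
Qed.

(** By [gapE] the gap is the difference of labels, plus N - 1 when it wraps past the label of
    v_n. *)
Lemma aseqE t : aseq sigma v t = rise circle_pos t.
Proof.
have idxS : cycle_index t.+1 = (t %% n.+2).+1%:R.
  have tlt := ltn_pmod t (ltn0Sn n.+1).
  rewrite -cycle_index_small ?ltnS //; apply/eqP; rewrite cycle_index_eq.
  by rewrite -[t.+1]addn1 -[(t %% _).+1]addn1 modnDml.
have aE : aseq sigma v t =
    gap sigma v (sigma (v (cycle_index t))) (sigma (v (cycle_index t.+1))).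
  by rewrite idxS /aseq /cycle_index /=; case: eqP => [->|].
have := gapE nv _ (sv_neq1 t) (sv_neq1 t.+1); rewrite -aE !repr1nE => aE'.
have {aE'} : (aseq sigma v t + (level t).+1 =
    (level t.+1).+1 + n.+2 * ((level t.+1).+1 < (level t).+1))%N.
  apply: aE'; rewrite sv_eq cycle_index_eq -[t.+1]addn1 -[X in X == _ %[mod _]]addn0.
  by rewrite eqn_modDl !modn_small.
have xy : circle_pos t.+1 != circle_pos t.
  by rewrite circle_pos_eq -[t.+1]addn1 -[X in _ == X %[mod _]]addn0 eqn_modDl !modn_small.
have := level_bound t; have := level_bound t.+1.
move: xy; rewrite /rise /circle_pos.
move: (level t) (level t.+1) (aseq sigma v t) => x y a yx yP xP aE'.
have {yx}xy : x != y by apply: contraNneq yx => ->.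
have alt : (a < n.+2)%N by move: aE'; case: ltnP; lia.
have -> : y%:R - x%:R = a%:R :> 'Z_n.+2.
  apply/eqP; rewrite subr_eq -natrD natr_Zp_eq.
  have -> : (a + x = y + (y < x) * n.+2)%N by rewrite -ltnS; lia.
  by rewrite addnC modnMDl.
by rewrite Zp_nat /= modn_small.
Qed.

Lemma reached_start (Y : {set V}) : v 0 \in Y -> exists h0 s0,
  (0 < s0 <= dwell v Y circle_pos 0)%N /\
  reached v Y circle_pos h0 0 s0 (sigma, 1, true).
Proof.
move=> Y0; have [_ v0 lt1] := nv.
have sgn0 : sign_at v Y 0 = true by [].
have idx1 : cycle_index 1 = 1 by rewrite cycle_index_small.
have lev : (level 1 < level 0)%N.
  by move: lt1; rewrite !repr1nE ltnS /level idx1 /cycle_index mod0n.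
(* The normalisation of the naming makes this difference wrap: going up from v_n, v_1 is met before
   v_(n-1). *)
have dwE : dwell v Y circle_pos 0 = (level 1 + n.+2 - level 0)%N.
  have := level_bound 0; have := level_bound 1.
  rewrite /dwell sgn0 mul1r /circle_pos => b1 b0.
  have -> : (level 1)%:R - (level 0)%:R = (level 1 + n.+2 - level 0)%:R :> 'Z_n.+2.
    apply/eqP; rewrite subr_eq -natrD natr_Zp_eq subnK ?modnDr //; lia.
  rewrite [LHS]val_Zp_nat // modn_small //; lia.
(* Label 2 is slot 1, so s0 must satisfy [circle_pos 0] + s0 = 1 modulo N - 1; h0 then makes i equal
   to 1. *)
pose s0 := (n.+3 - level 0)%N; exists (1 - s0%:R), s0.
have b0 := level_bound 0; have b1 := level_bound 1.
split; first by rewrite dwE /s0; lia.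
split=> //=; rewrite sgn0 /sgn_Zn.
  by rewrite /height big_nil addr0 subrK.
have -> : circle_pos 0 + s0%:R = 1.
  apply/eqP; rewrite -natrD (@natr_Zp_eq n _ 1) /s0 subnKC; last by lia.
  by rewrite -[n.+3]addn1 modnDl.
split=> [|j jP]; rewrite sgn0; first by rewrite addr0 -v0.
rewrite add0n; have bj := level_bound j.
rewrite offset_true /circle_pos; have -> : (level j)%:R - 1 = (level j).-1%:R :> 'Z_n.+2.
  by apply/eqP; rewrite subr_eq natr1 prednK //; lia.
have -> : val ((level j).-1%:R : 'Z_n.+2) = (level j).-1.
  by rewrite [LHS]val_Zp_nat // modn_small //; lia.
rewrite prednK; last by lia.
by rewrite /level natr_Zp /vertex -cycle_index_small // addrC subrK.
Qed.

End InitialState.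

Theorem theorem1p6 (n : nat) (V : finType) (E Erefl Erefr : {set {set V}})
    (sigma : labeling n V) (v : 'Z_n -> V) (m p : nat) (Y : {set V}) :
  (3 <= n)%N ->
  is_cycle_graph n E ->
  E = Erefl :|: Erefr ->
  [disjoint Erefl & Erefr] ->
  ~~ odd #|Erefr| ->
  naming E sigma v ->
  (0 < m)%N ->
  (\sum_(0 <= l < n.-1) aseq sigma v l = m * n.-1)%N ->
  is_min_period (aseq sigma v) p ->
  is_part1 Erefl Erefr (v 0) Y ->
  let mu := #|Y| in
  (fingraph.order (@Theta n V Erefl Erefr) (sigma, 1, true))%:R =
    (n%:R * p%:R) / (gcdn n mu)%:R *
      (mu%:R * m%:R + (n%:R - mu%:R) * (n%:R - 1 - m%:R)) :> rat.
Proof.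
case: n sigma v => [|[|[|n]]] // sigma v _ _ E_split E_disj _ nv _ sum_a a_min Y_part mu.
have [v_enum _ _] := nv; have [_ _ Y0] := Y_part.
set c := circle_pos sigma v; have c_eq := circle_pos_eq nv.
have aE := aseqE nv.
have sum_r : (\sum_(0 <= l < n.+2) rise c l = m * n.+2)%N.
  by rewrite -sum_a; apply: eq_bigr => l _; rewrite aE.
have r_min : is_min_period (rise c) p.
  case: a_min => -[p0 ap] pm; split; first by split=> // b; rewrite -!aE.
  by move=> q [q0 qp]; apply: pm; split=> // b; rewrite !aE.
have p0 : (0 < p)%N by case: r_min => -[].
have [h0 [s0 [s0P x0P]]] := reached_start nv Y0.
set g := gcdn n.+3 mu; pose r := (n.+3 %/ g)%N.
have g0 : (0 < g)%N by rewrite gcdn_gt0.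
have rg : (r * g = n.+3)%N by rewrite divnK ?dvdn_gcdl.
have r0 : (0 < r)%N by case: r rg.
have cop : coprime p n.+3.
  have [d dE] := dvdnP (p_dvd c_eq r_min).
  by rewrite -[n.+3]addn1 dE /coprime gcdnMDl gcdn1.
(* The time is a multiple of N and of p, so sign and gap both recur. *)
have dw_per : dwell v Y c (r * p * n.+3) = dwell v Y c 0.
  rewrite !(dwellE v Y c_eq) -[(r * p * n.+3)%N]add0n.
  rewrite (periodic_mul (r * p) 0 (sign_period Y v_enum)) mulnAC.
  by rewrite (periodic_mul (r * n.+3) 0 (rise_p r_min)).
have ret0 : returns v Y c h0 (r * p * n.+3).
  split; first exact: dvdn_mull.
    apply/c_shift => j; rewrite mulnAC.
    exact: (periodic_mul _ j (rise_p r_min)).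
  apply/(height_returns Y v_enum c_eq sum_r r_min h0 (dvdn_mull r (dvdnn p))).
  exact: dvdn_mulr.
have t_min t : (0 < t)%N -> returns v Y c h0 t -> (r * p * n.+3 <= t)%N.
  move=> t0 [/dvdnP[K KE] /c_shift /(min_period_dvdn r_min)].
  rewrite KE (Gauss_dvdl _ cop) => pK.
  move=> /(height_returns Y v_enum c_eq sum_r r_min h0 pK) rK.
  rewrite leq_pmul2r // dvdn_leq //; first by case: K KE t0 {pK rK} => // ->.
  rewrite Gauss_dvd ?rK //; rewrite coprime_sym; apply: coprime_dvdr cop.
  by rewrite -rg dvdn_mulr.
rewrite (order_Theta v_enum E_split E_disj Y_part c_eq s0P x0P _ ret0 dw_per t_min).
  rewrite (sum_dwell Y v_enum c_eq sum_r r_min).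
  (* The bounds mu <= N and m <= N - 1 turn truncated subtractions into rational ones. *)
  rewrite natrM natrM natrD natrM natrM !natrB ?(mu_le Y v_enum) ?(m_le c_eq sum_r r_min) //.
  have rE : n.+3%:R / g%:R = r%:R :> rat.
    by rewrite -rg natrM mulfK // Num.Theory.pnatr_eq0 -lt0n.
  have mE : n.+3%:R - 1 = n.+2%:R :> rat by rewrite -natr1 addrK.
  by rewrite [n.+3%:R * p%:R / _]mulrAC rE mE.
by rewrite !muln_gt0 r0 p0.
Qed.
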